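(* Let $C$ be a nonempty closed convex subset of $X$, let $F\colon X\to Y\cup\{+\infty_Y\}$ be a proper $K$-convex mapping such that $y^*\circ F$ is lower semicontinuous for all $y^*\in Y^*$, and let $G\colon X\to Z\cup\{+\infty_Z\}$ be a proper $S$-convex and $S$-epi closed mapping. Let $A:=C\cap G^{-1}(-S)$ and assume that $A\cap\operatorname{dom}F\neq\emptyset$. Then the following statements are equivalent: $(c')$ The set $$\bigcup_{T\in\mathcal{L}_+^w(S,K)}\Big[\bigcap_{v\in I_{-S}^*(T)}\big[\operatorname{epi}_K(F+I_C+T\circ G)^*+(0_{\mathcal{L}},v)\big]\Big]$$ is closed in $\mathcal{L}(X,Y)\times Y$. $(d)$ For every $(L,y)\in\mathcal{L}(X,Y)\times Y$, the following assertions $(b_1)$ and $(b_3)$ are equivalent: $(b_1)$ for all $x$: if $x\in C$ and $G(x)\in-S$, then $F(x)-L(x)+y\notin-\operatorname{int}K$; $(b_3)$ there exists $T\in\mathcal{L}_+^w(S,K)$ such that $F(x)+(T\circ G)(x)-L(x)+y\notin T(-S)-\operatorname{int}K$ for all $x\in C$.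
   Context: $X,Y,Z$ are (real) locally convex Hausdorff topological vector spaces with topological duals $X^*,Y^*,Z^*$; $K\subset Y$ is a closed, pointed, convex cone with $\operatorname{int}K\neq\emptyset$; $S\subset Z$ is a nonempty closed convex cone. Order and infinite elements: for $y_1,y_2\in Y$, $y_1<_K y_2$ means $y_1-y_2\in-\operatorname{int}K$. $Y^\bullet:=Y\cup\{-\infty_Y,+\infty_Y\}$, where $\pm\infty_Y\notin Y$ and $-\infty_Y<_K y<_K+\infty_Y$ for all $y\in Y$ (hence also $-\infty_Y<_K+\infty_Y$). Conventions: $-(+\infty_Y)=-\infty_Y$, $-(-\infty_Y)=+\infty_Y$, $(+\infty_Y)+y=y+(+\infty_Y)=+\infty_Y$ for $y\in Y\cup\{+\infty_Y\}$, $(-\infty_Y)+y=y+(-\infty_Y)=-\infty_Y$ for $y\in Y\cup\{-\infty_Y\}$. Analogous elements $\pm\infty_Z$ and conventions are used for $Z$ (ordered by $S$). Weak supremum: for $\emptyset\neq M\subset Y^\bullet$, $\operatorname{WSup}M$ is the set of $\bar v\in Y^\bullet$ such that $\bar v\not<_K v$ for all $v\in M$, and for every $\tilde v\in Y^\bullet$ with $\tilde v<_K\bar v$ there is $v\in M$ with $\tilde v<_K v$. Mappings: for $F\colon X\to Y^\bullet$, $\operatorname{dom}F=\{x\in X: F(x)\neq+\infty_Y\}$; $F$ is proper if $\operatorname{dom}F\neq\emptyset$ and $-\infty_Y\notin F(X)$; $\operatorname{epi}_KF=\{(x,y)\in X\times Y: y\in F(x)+K\}$; $F$ is $K$-convex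 if $\operatorname{epi}_KF$ is convex, and $K$-epi closed if it is closed. The same notions are used for $G$ with $(Z,S)$ in place of $(Y,K)$. For $y^*\in Y^*$, $(y^*\circ F)(x)=y^*(F(x))$ if $F(x)\in Y$ and $+\infty$ if $F(x)=+\infty_Y$. $\mathcal{L}(X,Y)$ is the space of continuous linear mappings $X\to Y$ with the topology of pointwise convergence; $0_{\mathcal{L}}$ is its zero element. The conjugate of $F$ is the set-valued map $F^*(L)=\operatorname{WSup}\{L(x)-F(x):x\in X\}$, $L\in\mathcal{L}(X,Y)$, and $\operatorname{epi}_KF^*=\{(L,y)\in\mathcal{L}(X,Y)\times Y: y\in F^*(L)+K\}$. For a set $D$ in $X$ (or in $Z$), $I_D(x)=0_Y$ if $x\in D$ and $I_D(x)=+\infty_Y$ otherwise; in particular, for $-S\subset Z$ and $T\in\mathcal{L}(Z,Y)$, $I_{-S}^*(T)=\operatorname{WSup}T(-S)$. For $T\in\mathcal{L}(Z,Y)$, $(T\circ G)(x)=T(G(x))$ if $G(x)\in Z$ and $+\infty_Y$ if $G(x)=+\infty_Z$. $\mathcal{L}_+^w(S,K)=\{T\in\mathcal{L}(Z,Y): T(S)\cap(-\operatorname{int}K)=\emptyset\}$. *)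

(* Defs.v *)
(* [tvsType R] is the class of locally convex topological vector spaces; being
   Hausdorff is a separate hypothesis, [hausdorff_space]. *)
From HB Require Import structures.
From mathcomp Require Import all_boot all_order all_algebra.
From mathcomp Require Import all_classical all_reals all_analysis.

Set Implicit Arguments.
Unset Strict Implicit.
Unset Printing Implicit Defensive.

Import Order.TTheory GRing.Theory Num.Theory.
Import numFieldNormedType.Exports.

Local Open Scope classical_set_scope.
Local Open Scope ring_scope.

Section LinCont.
Context (R : realType) (U V : tvsType R).

Definition is_lincont : {pred U -> V} :=
  [pred f : U -> V | `[< linear f /\ continuous f >]].

Record lincont := LinCont {
  lincont_fun : U -> V ;
  _ : lincont_fun \in is_lincont }.

HB.instance Definition _ := [isSub for lincont_fun].
HB.instance Definition _ := [Choice of lincont by <:].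

Lemma is_lincont_submod_closed : submod_closed is_lincont.
Proof.
split=> [|a f g]; rewrite !inE /=.
  split; first by move=> b x y; rewrite /= scaler0 addr0.
  by move=> x; exact: cvg_cst.
move=> [lf cf] [lg cg]; split.
  move=> b x y.
  rewrite -[LHS]/(a *: f (b *: x + y) + g (b *: x + y)) lf lg.
  rewrite -[RHS]/(b *: (a *: f x + g x) + (a *: f y + g y)).
  by rewrite !scalerDr !scalerA [a * b]mulrC addrACA.
have cZ : continuous (fun x => a *: f x).
  move=> x; apply: (@continuous_comp _ _ _ (fun x => (a : R^o, f x))
    (fun z : R^o * V => z.1 *: z.2)); last exact: scale_continuous.
  by apply: (@cvg_pair _ _ _ _ (nbhs (a : R^o)) (nbhs (f x)));
    [exact: cvg_cst|exact: cf].
move=> x; apply: (@continuous_comp _ _ _ (fun x => (a *: f x, g x))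
  (fun z : V * V => z.1 + z.2)); last exact: add_continuous.
by apply: (@cvg_pair _ _ _ _ (nbhs (a *: f x)) (nbhs (g x)));
  [exact: cZ|exact: cg].
Qed.

HB.instance Definition _ :=
  GRing.isSubmodClosed.Build R (U -> V) is_lincont is_lincont_submod_closed.
HB.instance Definition _ := [SubChoice_isSubLmodule of lincont by <:].

(* The topology of pointwise convergence. *)
HB.instance Definition _ := Topological.copy lincont
  (initial_topology (lincont_fun : lincont -> {ptws U -> V})).

Lemma lincont_linear (f : lincont) : linear (lincont_fun f).
Proof. by case: f => f /=; rewrite inE => -[]. Qed.

Lemma lincont_continuous (f : lincont) : continuous (lincont_fun f).
Proof. by case: f => f /=; rewrite inE => -[]. Qed.

HB.instance Definition _ (f : lincont) :=
  GRing.isLinear.Build R U V *:%R (lincont_fun f) (lincont_linear f).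

End LinCont.

Coercion lincont_fun : lincont >-> Funclass.

Notation "''L' ( U , V )" := (lincont U V)
  (at level 8, format "''L' ( U ,  V )") : type_scope.

Section Cones.
Context (R : realType) (Y : tvsType R).

Definition is_cone (K : set Y) :=
  forall (t : R) (y : Y), 0 <= t -> K y -> K (t *: y).

Definition is_pointed (K : set Y) := K `&` (-%R @` K) = [set 0].

End Cones.

(* The set Y^• of the elements of Y and of -oo, +oo is the library type
   [\bar Y].  The library sets -oo + +oo = -oo, a sum that the theory leaves
   undefined; it never occurs for mappings that avoid -oo. *)

Section WeakOrder.
Context (R : realType) (Y : tvsType R) (K : set Y).
Local Open Scope ereal_scope.

Definition wlt (u v : \bar Y) : Prop :=
  match u, v with
  | y1%:E, y2%:E => (-%R @` K°) (y1 - y2)%R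
  | -oo, _%:E | -oo, +oo | _%:E, +oo => True
  | _, _ => False
  end.

(* The notion is meant for nonempty M. *)
Definition WSup (M : set (\bar Y)) : set (\bar Y) :=
  [set vbar | (forall v, M v -> ~ wlt vbar v) /\
    (forall vt, wlt vt vbar -> exists2 v, M v & wlt vt v)].

End WeakOrder.

Section Mappings.
Context (R : realType) (X Y : tvsType R).
Implicit Types (F : X -> \bar Y) (K : set Y).
Local Open Scope ereal_scope.

Definition effdom F : set X := [set x | F x <> +oo].

Definition proper_map F := effdom F !=set0 /\ (forall x, F x <> -oo).

(* Epigraph of a set-valued mapping H : T -> 2^(Y^•); only finite elements of
   H t contribute, since the second component is in Y. *)
Definition sepi (T : Type) K (H : T -> set (\bar Y)) : set (T * Y) :=
  [set p | exists2 v, H p.1 v & exists2 k, K k & p.2%:E = v + k%:E].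

Definition epi K F : set (X * Y) := sepi K (fun x => [set F x]).

Definition Kconvex K F :=
  convex_set (epi K F : set (convex_lmodType (X * Y)%type)).

Definition epi_closed K F := closed (epi K F).

Definition conjugate K F : 'L(X, Y) -> set (\bar Y) :=
  fun L => WSup K (range (fun x => (L x)%:E - F x)).

Definition indicator (D : set X) : X -> \bar Y :=
  fun x => if x \in D then 0 else +oo.

End Mappings.

Arguments indicator {R X Y} D.

Section PositiveOperators.
Context (R : realType) (Y Z : tvsType R).

Definition Lplus_w (S : set Z) (K : set Y) : set 'L(Z, Y) :=
  [set T | (T @` S) `&` (-%R @` K°) = set0].

(* For T in Lplus_w, the set I_{-S}^*(T) consists of elements of Y, so
   quantifying over its elements v%:E with v : Y loses nothing. *)
Lemma conjugate_indicator_fin (S : set Z) (K : set Y) (T : 'L(Z, Y))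
    (v : \bar Y) :
  S 0 -> Lplus_w S K T -> conjugate K (indicator (-%R @` S)) T v ->
  exists y : Y, v = y%:E.
Proof.
move=> S0 TS []; case: v => [y _ _| _ /(_ 0%:E I)|+ _]; first by exists y.
- case=> _ [z _ <-]; rewrite /indicator; case: ifPn => //.
  rewrite inE => -[s Ss <-] /=; rewrite oppr0 addr0 sub0r raddfN opprK => Ts.
  have : ((T @` S) `&` (-%R @` K°)) (T s) by split => //; exists s.
  by rewrite TS.
- move=> /(_ (T 0)%:E); case=> //; exists 0 => //.
  rewrite /indicator mem_set /= ?oppr0 ?addr0//.
  by exists 0 => //; rewrite oppr0.
Qed.

End PositiveOperators.

(* Main.v *)
Require Import Defs.
From HB Require Import structures.
From mathcomp Require Import all_boot all_order all_algebra.
From mathcomp Require Import all_classical all_reals all_analysis.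
From mathcomp Require Import ring lra.

(** Both sides of the equivalence speak about two conditions on a pair (L, y).  The
    primal bound says that F - L + y avoids - K° on the feasible set, and the dual
    bound that some operator T certifies this on all of C ([primal_bound],
    [dual_bound_by]).

    The set whose closedness is at stake consists exactly of the pairs with a dual
    bound ([bigcap_epi_conjugateP]).  Indeed a point is in the epigraph of a conjugate
    as soon as it is not below any of the values whose weak supremum is taken
    ([sepi_conjugateP]), and the weak supremum of T(-S) has the same points
    strictly below it as T(-S) itself ([conjugate_indicator_interior]); both
    facts come from descending along a ray until the last point that is not
    below the set ([WSup_ray]).

    A dual bound implies the primal bound ([dual_bound_by_primal]), and the pairs
    with a primal bound form an intersection of closed sets
    ([primal_bound_closed]).  So the theorem amounts to the density of the dual
    bounds among the primal ones ([primal_bound_approx]), which holds without any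
    constraint qualification.

    For the density, a primal bound is first scalarized by a functional phi that
    is positive on the interior of K ([scalarize]).  The scalar statement is
    about a closed convex set W in X * Z * R, the epigraph of a function of x and
    of a perturbation z of the constraint: if the function is nonnegative at
    z = 0, then arbitrarily small affine perturbations of it, small at finitely
    many prescribed points, have a multiplier ([dual_set_approx]).  Otherwise the
    values of the perturbations that have a multiplier could be separated from 0
    in finite dimension, hence by an evaluation at some x0; but separating
    (- x0, 0, - a / 2) from W yields an admissible perturbation on the wrong side
    ([dual_set_not_separated]).  Finally the scalar multiplier and perturbation are
    multiplied by a fixed element of the interior of K to obtain the operators T
    and L.

    All separations derive from the Hahn-Banach theorem, which is proved by
    taking a minimal sublinear functional: such a functional is linear. *)

Set Implicit Arguments.
Unset Strict Implicit.
Unset Printing Implicit Defensive.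
Import Order.TTheory GRing.Theory Num.Theory.
Import numFieldNormedType.Exports.
Local Open Scope classical_set_scope.
Local Open Scope ring_scope.

(** * The Hahn-Banach theorem *)

Section HahnBanach.
Context (R : realType) (V : lmodType R).
Implicit Types (p q : V -> R) (x y v : V).

(** Only the inequality is asked of the scaling; equality and the value at the
    origin follow. *)
Definition sublinear q :=
  (forall x y, q (x + y) <= q x + q y) /\
  (forall t x, 0 < t -> q (t *: x) <= t * q x).

Lemma sublinearZ q t x : sublinear q -> 0 < t -> q (t *: x) = t * q x.
Proof.
move=> [_ qZ] t0; apply/eqP; rewrite eq_le qZ//=.
have := qZ t^-1 (t *: x); rewrite invr_gt0 => /(_ t0).
by rewrite scalerA mulVf ?gt_eqF// scale1r mulrC ler_pdivlMr// mulrC.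
Qed.

Lemma sublinear0 q : sublinear q -> q 0 = 0.
Proof.
by move=> qs; have := sublinearZ 0 qs (ltr0Sn R 1); rewrite scaler0; lra.
Qed.

Lemma sublinear_oppr q x : sublinear q -> - q (- x) <= q x.
Proof.
move=> qs; have := qs.1 x (- x); rewrite subrr sublinear0//; lra.
Qed.

(** Lowering q in the direction v as far as sublinearity permits.  The tilted
    functional lies below q and satisfies [tilt q v (- v) <= - q v], so that a
    functional that tilting cannot lower any further is odd and additive. *)
Definition tilt q v x :=
  inf [set q (x + t *: v) - t * q v | t in [set t | 0 <= t]].

Lemma tilt_le q v x t : sublinear q -> 0 <= t ->
  tilt q v x <= q (x + t *: v) - t * q v.
Proof.
move=> qs t0; apply: ge_inf; last by exists t.
exists (- q (- x)) => _ [s /= s0 <-]; rewrite lerBrDl.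
have [->|s1] := eqVneq s 0.
  by rewrite mul0r scale0r addr0 add0r sublinear_oppr.
rewrite -sublinearZ//; last by rewrite lt_def s1.
by have := qs.1 (x + s *: v) (- x); rewrite addrAC subrr add0r; lra.
Qed.

Lemma le_tilt q v x (c : R) :
  (forall t, 0 <= t -> c <= q (x + t *: v) - t * q v) -> c <= tilt q v x.
Proof.
move=> h; apply: lb_le_inf.
  by exists (q (x + 0 *: v) - 0 * q v); exists 0 => /=.
by move=> _ [t /= t0 <-]; exact: h.
Qed.

Lemma tilt_le_id q v x : sublinear q -> tilt q v x <= q x.
Proof.
by move=> qs; have := tilt_le v x qs (lexx 0); rewrite scale0r mul0r addr0 subr0.
Qed.

Lemma tilt_sublinear q v : sublinear q -> sublinear (tilt q v).
Proof.
move=> qs; split=> [x y|t x t0].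
  rewrite -lerBlDr; apply: le_tilt => t t0; rewrite lerBlDr -lerBlDl.
  apply: le_tilt => s s0.
  have := tilt_le v (x + y) qs (addr_ge0 t0 s0).
  have := qs.1 (x + t *: v) (y + s *: v).
  by rewrite addrACA -scalerDl mulrDl; lra.
rewrite -ler_pdivrMl//; apply: le_tilt => s s0.
rewrite ler_pdivrMl// mulrBr mulrA -sublinearZ// scalerDr scalerA.
by apply: tilt_le => //; rewrite mulr_ge0// ltW.
Qed.

(** Minimality turns [tilt q y <= q] into an equality, and then taking t = 1 in
    the infimum gives [q x <= q (x + y) - q y]. *)
Lemma minimal_sublinear_linear q : sublinear q ->
  (forall q', sublinear q' -> (forall x, q' x <= q x) -> q' = q) ->
  linear (q : V -> R^o).
Proof.
move=> qs qmin.
have qD x y : q (x + y) = q x + q y.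
  apply/eqP; rewrite eq_le qs.1/= -lerBrDr.
  rewrite -{1}(qmin _ (tilt_sublinear y qs) (fun x => tilt_le_id y x qs)).
  by have := tilt_le y x qs ler01; rewrite scale1r mul1r.
have qN x : q (- x) = - q x.
  by have := qD x (- x); rewrite subrr sublinear0//; lra.
move=> t x y; rewrite qD; congr (_ + _).
suff : q (t *: x) = t * q x by [].
have [t0|t0|->] := ltgtP t 0.
- rewrite -[t]opprK scaleNr qN sublinearZ ?oppr_gt0//; ring.
- exact: sublinearZ.
- by rewrite scale0r mul0r sublinear0.
Qed.

(** Zorn's lemma, for the order in which smaller functionals come later: the
    pointwise infimum of a chain is finite because every sublinear [q <= p]
    satisfies [- p (- x) <= q x], and it is subadditive because two members of
    a chain can be replaced by the smaller one. *)
Lemma exists_minimal_sublinear p : sublinear p ->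
  exists2 q, sublinear q /\ (forall x, q x <= p x) &
    forall q', sublinear q' -> (forall x, q' x <= q x) -> q' = q.
Proof.
move=> ps.
pose T := {q : V -> R | `[< sublinear q /\ forall x, q x <= p x >]}.
have TP (q : T) : sublinear (val q) /\ forall x, val q x <= p x.
  by have /asboolP := valP q.
pose leT (q q' : T) := `[< forall x, val q' x <= val q x >].
have mkT q : sublinear q -> (forall x, q x <= p x) -> {q' : T | val q' = q}.
  by move=> qs qp; have h := asboolT (conj qs qp); exists (exist _ q h).
have [||||q qmin] := @Zorn T leT.
- by move=> q; apply/asboolP.
- move=> a b c /asboolP ab /asboolP bc; apply/asboolP => x.
  exact: le_trans (bc x) (ab x).
- move=> a b /asboolP ab /asboolP ba; apply/val_inj/funext => x.
  by apply/le_anti; rewrite ab ba.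
- move=> A Atot; have [[a Aa]|A0] := pselect (A !=set0); last first.
    have [t tp] := mkT p ps (fun x => lexx _).
    by exists t => s As; exfalso; apply: A0; exists s.
  pose m x := inf [set val (q : T) x | q in A].
  have m_le (q : T) x : A q -> m x <= val q x.
    move=> Aq; apply: ge_inf; last by exists q.
    exists (- p (- x)) => _ [b Ab <-].
    apply: le_trans (sublinear_oppr x (TP b).1); rewrite lerN2; exact: (TP b).2.
  have le_m c x : (forall q : T, A q -> c <= val q x) -> c <= m x.
    move=> h; apply: lb_le_inf; first by exists (val a x); exists a.
    by move=> _ [q Aq <-]; exact: h.
  have ms : sublinear m.
    split=> [x y|t x t0].
      rewrite -lerBlDr; apply: (le_m) => q Aq; rewrite lerBlDr -lerBlDl.
      apply: le_m => q' Aq'; rewrite lerBlDl.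
      have [/asboolP qq'|/asboolP qq'] := Atot _ _ Aq Aq'.
        apply: le_trans (m_le q' (x + y) Aq') _.
        by apply: le_trans ((TP q').1.1 x y) _; rewrite lerD2r.
      apply: le_trans (m_le q (x + y) Aq) _.
      by apply: le_trans ((TP q).1.1 x y) _; rewrite lerD2l.
    rewrite -ler_pdivrMl//; apply: le_m => q Aq; rewrite ler_pdivrMl//.
    exact: le_trans (m_le q _ Aq) ((TP q).1.2 t x t0).
  have [t tm] := mkT m ms (fun x => le_trans (m_le a x Aa) ((TP a).2 x)).
  by exists t => s As; apply/asboolP => x; rewrite tm; exact: m_le.
exists (val q); first exact: TP.
move=> q' q's q'q.
have [t tq'] := mkT q' q's (fun x => le_trans (q'q x) ((TP q).2 x)).
by rewrite -tq' (qmin t)//; apply/asboolP; rewrite tq'.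
Qed.

(** A minimal sublinear functional below [tilt p v], rather than below p, also
    satisfies [f (- v) <= - p v], which makes the bound tight at v. *)
Theorem Hahn_Banach p v : sublinear p ->
  exists f : {linear V -> R^o}, (forall x, f x <= p x) /\ f v = p v.
Proof.
move=> ps.
have [q [qs qp] qmin] := exists_minimal_sublinear (tilt_sublinear v ps).
pose qL := GRing.isLinear.Build R V R^o *:%R q (minimal_sublinear_linear qs qmin).
pose f : {linear V -> R^o} := HB.pack q qL.
have fp x : f x <= p x by exact: le_trans (qp x) (tilt_le_id v x ps).
exists f; split=> //; apply/eqP; rewrite eq_le fp/=.
have := le_trans (qp (- v)) (tilt_le v (- v) ps ler01).
rewrite scale1r addNr mul1r sublinear0// sub0r -[q (- v)]/(f (- v)) linearN/=.
by rewrite lerN2.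
Qed.

End HahnBanach.

(** * Separation of convex sets without topology *)

Section Separation.
Context (R : realType) (V : lmodType R).
Implicit Types (A B Q U W : set V) (x y v w : V).

Lemma convex_setP A : convex_set (A : set (convex_lmodType V)) <->
  forall a b x y, 0 <= a -> 0 <= b -> a + b = 1 -> A x -> A y ->
    A (a *: x + b *: y).
Proof.
split=> [Ac a b x y a0 b0 ab Ax Ay|Ac x y l].
  have a1 : a <= 1 by rewrite -ab lerDl.
  have := Ac x y (Itv01 a0 a1); rewrite !inE => /(_ Ax Ay).
  by have -> : b = 1 - a by rewrite -ab addrAC subrr add0r.
rewrite !inE => Ax Ay.
have : A (l%:num *: (x : V) + (1 - l%:num) *: (y : V)).
  by apply: Ac => //; rewrite ?subr_ge0// addrC subrK.
by [].
Qed.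

Definition absorbing U := forall x, exists2 t, 0 < t & U (t *: x).

Lemma absorbing0 U : absorbing U -> U 0.
Proof. by move=> /(_ 0)[t _]; rewrite scaler0. Qed.

Lemma convex_shrink B t x : convex_set (B : set (convex_lmodType V)) -> B 0 ->
  0 <= t <= 1 -> B x -> B (t *: x).
Proof.
move=> /convex_setP Bc B0 /andP[t0 t1] Bx.
rewrite -[t *: x]addr0 -(scaler0 V (1 - t)).
by apply: Bc => //; rewrite ?subr_ge0// addrC subrK.
Qed.

Definition gauge B x := inf [set t : R | 0 < t /\ B (t^-1 *: x)].

Lemma gauge_le B x t : 0 < t -> B (t^-1 *: x) -> gauge B x <= t.
Proof. by move=> t0 Bx; apply: ge_inf => //; exists 0 => s [/ltW]. Qed.

Lemma le_gauge B x (c : R) : absorbing B ->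
  (forall t, 0 < t -> B (t^-1 *: x) -> c <= t) -> c <= gauge B x.
Proof.
move=> Ba h; apply: lb_le_inf => [|t [t0 Bx]]; last exact: h.
have [t t0 Bx] := Ba x.
by exists t^-1; split; [rewrite invr_gt0|rewrite invrK].
Qed.

Lemma gauge_sublinear B : convex_set (B : set (convex_lmodType V)) ->
  absorbing B -> sublinear (gauge B).
Proof.
move=> /convex_setP Bc Ba; split=> [x y|t x t0].
  rewrite -lerBlDr; apply: le_gauge => // t t0 Bx; rewrite lerBlDr -lerBlDl.
  apply: le_gauge => // s s0 By; rewrite lerBlDl.
  have ts0 : 0 < t + s by rewrite addr_gt0.
  apply: gauge_le => //.
  have -> : (t + s)^-1 *: (x + y) =
      (t / (t + s)) *: (t^-1 *: x) + (s / (t + s)) *: (s^-1 *: y).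
    by rewrite !scalerA scalerDr; congr (_ *: _ + _ *: _); field; lra.
  by apply: Bc => //; rewrite ?divr_ge0 ?ltW//; field; lra.
rewrite -ler_pdivrMl//; apply: le_gauge => // s s0 Bx; rewrite ler_pdivrMl//.
apply: gauge_le; first exact: mulr_gt0.
by rewrite invfM scalerA mulrAC mulVf ?gt_eqF// mul1r.
Qed.

(** The translate [q0 - Q] is convex and absorbing, and it misses q0 because Q
    misses the origin; so its gauge is at least 1 at q0, and a linear functional
    below the gauge that agrees with it at q0 is at most 1 on [q0 - Q]. *)
Lemma convex_separation Q (q0 : V) :
  convex_set (Q : set (convex_lmodType V)) ->
  absorbing [set x | Q (q0 - x)] -> ~ Q 0 ->
  exists f : {linear V -> R^o}, 0 < f q0 /\ forall q, Q q -> 0 <= f q.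
Proof.
move=> /convex_setP Qc Ba Q0; pose B := [set x | Q (q0 - x)].
have Bc : convex_set (B : set (convex_lmodType V)).
  apply/convex_setP => a b x y a0 b0 ab Bx By; rewrite /B/=.
  have -> : q0 - (a *: x + b *: y) = a *: (q0 - x) + b *: (q0 - y).
    by rewrite !scalerBr addrACA -scalerDl ab scale1r -opprD.
  exact: Qc.
have [f [fB fq0]] := Hahn_Banach q0 (gauge_sublinear Bc Ba).
have fq0_ge1 : 1 <= f q0.
  rewrite fq0; apply: le_gauge => // t t0 Bq; rewrite leNgt; apply/negP => t1.
  apply: Q0; rewrite -(subrr q0).
  have := @convex_shrink B t _ Bc (absorbing0 Ba) _ Bq; rewrite (ltW t0) (ltW t1).
  by move=> /(_ isT); rewrite /B/= scalerA mulfV ?gt_eqF// scale1r.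
exists f; split=> [|q Qq]; first exact: lt_le_trans fq0_ge1.
have : f (q0 - q) <= 1.
  by apply: le_trans (fB _) (gauge_le ltr01 _); rewrite invr1 scale1r /B/= subKr.
rewrite linearB/= => fq.
suff : f q0 - f q <= f q0 by rewrite gerBl.
exact: le_trans fq0_ge1.
Qed.

(** Room U around W upgrades separation from the origin in two ways: the gap is
    uniform on W, and f is bounded below on U, which amounts to continuity when U
    is a neighbourhood of the origin. *)
Lemma convex_strict_separation W U : W !=set0 ->
  convex_set (W : set (convex_lmodType V)) ->
  convex_set (U : set (convex_lmodType V)) ->
  absorbing U -> (forall u, U u -> U (- u)) -> (forall w, W w -> ~ U w) ->
  exists f : {linear V -> R^o}, exists2 e : R, 0 < e &
    (forall w, W w -> e <= f w) /\ exists M : R, forall u, U u -> M <= f u.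
Proof.
move=> [w0 Ww0] /convex_setP Wc /convex_setP Uc Ua UN WU.
pose Q := [set w + u | w in W & u in U].
have U0 := absorbing0 Ua.
have Qc : convex_set (Q : set (convex_lmodType V)).
  apply/convex_setP => a b _ _ a0 b0 ab [w Ww [u Uu <-]] [w' Ww' [u' Uu' <-]].
  exists (a *: w + b *: w'); first exact: Wc.
  exists (a *: u + b *: u'); first exact: Uc.
  by rewrite !scalerDr addrACA.
have [|[w Ww [u Uu wu]]|f [fw0 fQ]] := convex_separation (q0 := w0) Qc.
- move=> x; have [t t0 Ux] := Ua (- x); exists t => //=; exists w0 => //.
  by exists (t *: - x) => //; rewrite scalerN.
- apply: (WU w Ww); suff -> : w = - u by exact: UN.
  by apply/eqP; rewrite -subr_eq0 opprK wu.
have [t t0 Utw] := Ua w0.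
exists f, (t * f w0); first exact: mulr_gt0.
split=> [w Ww|].
  have : 0 <= f (w + - (t *: w0)).
    by apply: fQ; exists w => //; exists (- (t *: w0)) => //; exact: UN.
  by rewrite linearB linearZ/= subr_ge0.
exists (- f w0) => u Uu.
have : 0 <= f (w0 + u) by apply: fQ; exists w0 => //; exists u.
by rewrite linearD/= -lerBlDl sub0r.
Qed.

End Separation.

(** * Separation in locally convex spaces *)

Lemma pair_continuous (T U V : topologicalType) (f : T -> U) (g : T -> V) :
  continuous f -> continuous g -> continuous (fun x => (f x, g x)).
Proof.
move=> fc gc x.
by apply: (@cvg_pair _ _ _ _ (nbhs (f x)) (nbhs (g x))); [exact: fc|exact: gc].
Qed.

Lemma lincont_of_linear (R : realType) (U V : tvsType R) (f : U -> V) :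
  linear f -> continuous f -> exists g : 'L(U, V), forall x, g x = f x.
Proof.
move=> fl fc; have h : f \in @is_lincont R U V by rewrite inE.
by exists (LinCont h).
Qed.

Section TvsSeparation.
Context (R : realType) (V : tvsType R).
Implicit Types (U W : set V) (x y v w : V).

Lemma nbhs0_scale U x : nbhs 0 U ->
  exists2 e : R, 0 < e & forall t, `|t| < e -> U (t *: x).
Proof.
move=> U0.
have : (fun t : R^o => t *: x) @ (0 : R^o) --> (0 : V).
  suff : (fun t : R^o => t *: x) @ (0 : R^o) --> (0 : R) *: x by rewrite scale0r.
  apply: (@continuous_comp _ _ _ (fun t : R^o => (t, x))
    (fun z : R^o * V => z.1 *: z.2)); last exact: scale_continuous.
  by apply: pair_continuous => ?; [exact: cvg_id|exact: cvg_cst].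
move=> /(_ U U0) /nbhs_ballP[e /= e0 eU]; exists e => // t te.
by apply: eU; rewrite -ball_normE /= sub0r normrN.
Qed.

Lemma nbhs0_absorbing U : nbhs 0 U -> absorbing U.
Proof.
move=> U0 x; have [e e0 eU] := nbhs0_scale x U0.
exists (e / 2); first by rewrite divr_gt0.
apply: eU; rewrite gtr0_norm ?divr_gt0//.
by rewrite ltr_pdivrMr// mulr_natr mulr2n ltrDl.
Qed.

Lemma nbhs0_symm U : nbhs 0 U -> nbhs 0 (U `&` -%R @` U).
Proof. by move=> U0; apply: filterI => //; exact: nbhs0N. Qed.

(** A lower bound on U is a two-sided bound on the symmetric part of U, whose
    small multiples are then mapped into small balls. *)
Lemma bounded_below_continuous (f : {linear V -> R^o}) U (M : R) :
  nbhs 0 U -> (forall u, U u -> M <= f u) -> continuous f.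
Proof.
move=> U0 fM x; apply/cvgrPdist_lt => e e0.
pose m := `|M| + 1; have m0 : 0 < m by rewrite ltr_wpDl.
have /(nbhsT x) := nbhs0Z (lt0r_neq0 (divr_gt0 e0 m0)) (nbhs0_symm U0).
apply: filterS => _ [_ [u [Uu [u' Uu' uu']] <-] <-].
rewrite linearD linearZ/= opprD addrA subrr sub0r normrN normrM gtr0_norm ?divr_gt0//.
rewrite mulrAC ltr_pdivrMr// ltr_pM2l//.
apply: (@le_lt_trans _ _ `|M|); last by rewrite ltrDl.
have := fM _ Uu; have := fM _ Uu'.
rewrite -[u']opprK uu' linearN/= => h1 h2.
have := ler_norm (- M); rewrite normrN => h3.
by rewrite ler_norml; apply/andP; split; lra.
Qed.

(** The functional given by algebraic separation is nonnegative on W; since W is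
    open, moving slightly against a point where it is positive makes it positive
    on all of W. *)
Lemma open_convex_separation W : open W -> W !=set0 ->
  convex_set (W : set (convex_lmodType V)) -> ~ W 0 ->
  exists f : 'L(V, R^o), forall w, W w -> 0 < f w.
Proof.
move=> Wo [w0 Ww0] Wc W0.
have Wsub w : W w -> nbhs 0 [set x | W (w - x)].
  move=> Ww; have : nbhs w W by exact: open_nbhs_nbhs.
  move=> /(nbhsB (- w)); rewrite addNr => /nbhs0N.
  apply: filterS => _ [_ [v Wv <-] <-] /=.
  by rewrite opprK addrA subrr add0r.
have [f [fw0 fW]] := convex_separation Wc (nbhs0_absorbing (Wsub _ Ww0)) W0.
have fc : continuous f.
  have := bounded_below_continuous (M := - f w0) (nbhs0N (Wsub _ Ww0)).
  apply => _ [u Wu <-].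
  by rewrite linearN lerN2/= -subr_ge0 -linearB; exact: fW.
have [g gf] := lincont_of_linear (@linearP _ _ _ _ f) fc.
exists g => w Ww; rewrite gf.
have [t t0 Wt] := nbhs0_absorbing (Wsub w Ww) w0.
have := fW _ Wt; rewrite linearB linearZ/= subr_ge0.
by apply: lt_le_trans; exact: mulr_gt0.
Qed.

Lemma closed_convex_separation W v : closed W ->
  convex_set (W : set (convex_lmodType V)) -> ~ W v ->
  exists f : 'L(V, R^o), exists2 e : R, 0 < e & forall w, W w -> f v + e <= f w.
Proof.
move=> Wcl Wc Wv; have [Wne|W0] := pselect (W !=set0); last first.
  by exists 0, 1 => // w Ww; exfalso; apply: W0; exists w.
pose W' := [set w - v | w in W].
have W'c : convex_set (W' : set (convex_lmodType V)).
  move/convex_setP : Wc => Wc.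
  apply/convex_setP => a b _ _ a0 b0 ab [w Ww <-] [w' Ww' <-].
  exists (a *: w + b *: w'); first exact: Wc.
  by rewrite !scalerBr addrACA -opprD -scalerDl ab scale1r.
have : nbhs v (~` W) by apply: open_nbhs_nbhs; split => //; rewrite openC.
move=> /(nbhsB (- v)); rewrite addNr => N.
have [B Bc [Bo /(_ _ _ N)]] := @locally_convex R V.
rewrite nbhs_filterE => -[U [BU U0] UN].
have U0n : nbhs 0 U by apply: open_nbhs_nbhs; split=> //; exact: Bo.
have /convex_setP Uc := Bc _ (mem_set BU).
pose U' := U `&` -%R @` U.
have U'c : convex_set (U' : set (convex_lmodType V)).
  apply/convex_setP => a b x y a0 b0 ab [Ux [x' Ux' xE]] [Uy [y' Uy' yE]].
  split; first exact: Uc.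
  exists (a *: x' + b *: y'); first exact: Uc.
  by rewrite -xE -yE !scalerN opprD.
have U'a := nbhs0_absorbing (nbhs0_symm U0n).
have [|||f [e e0 [fW [M fU]]]] := convex_strict_separation _ W'c U'c U'a.
- by have [w Ww] := Wne; exists (w - v), w.
- by move=> u [Uu [u' Uu' uE]]; split; [rewrite -uE opprK|exists u].
- move=> _ [w Ww <-] [/UN[w' w'W] /=]; rewrite addrC => /addIr ww' _.
  by apply: w'W; rewrite ww'.
have fc := bounded_below_continuous (nbhs0_symm U0n) fU.
have [g gf] := lincont_of_linear (@linearP _ _ _ _ f) fc.
exists g, e => // w Ww; rewrite !gf.
have /fW : W' (w - v) by exists w.
by rewrite linearB/=; lra.
Qed.

End TvsSeparation.

(** * Approximate multipliers for a convex perturbation problem *)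

(** W is the epigraph of a closed convex function of x and of a perturbation z,
    and the hypothesis [W_ge0] bounds the unperturbed function below by 0.  A
    multiplier zeta certifies such a bound for the function minus [xi - b] when
    [(xi, b)] is in [dual_set]; without a constraint qualification the pair
    [(0, 0)] need not have a multiplier, and what is shown is that it is a limit
    of pairs that have one. *)
Section Perturbation.
Context (R : realType) (X Z : tvsType R).
Variable W : set (X * Z * R^o).
Hypothesis W_closed : closed W.
Hypothesis W_convex : convex_set (W : set (convex_lmodType (X * Z * R^o)%type)).
Hypothesis W_up : forall x z (m r : R), 0 <= r -> W (x, z, m) -> W (x, z, m + r).
Hypothesis W_ge0 : forall x (m : R), W (x, 0, m) -> 0 <= m.
Hypothesis W_feasible : exists x (m : R), W (x, 0, m).

Definition dual_set : set ('L(X, R^o) * R) :=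
  [set d : 'L(X, R^o) * R | exists zeta : 'L(Z, R^o),
  forall x z (m : R), W (x, z, m) -> 0 <= m + (zeta z : R) - (d.1 x : R) + d.2].

Lemma triple_linear_split (f : 'L((X * Z * R^o)%type, R^o)) :
  exists (xi : 'L(X, R^o)) (zeta : 'L(Z, R^o)) (tau : R),
  forall x z (m : R), f (x, z, m) = (xi x : R) + (zeta z : R) + m * tau.
Proof.
have [xi xiE] : exists xi : 'L(X, R^o), forall x, xi x = f (x, 0, 0).
  apply: lincont_of_linear => [a x y|x].
    by rewrite -linearP; congr (f _); congr (_, _, _); rewrite /= scaler0 addr0.
  apply: continuous_comp; last exact: lincont_continuous.
  by do 2?apply: pair_continuous => ?; [exact: cvg_id|exact: cvg_cst..].
have [zeta zetaE] : exists zeta : 'L(Z, R^o), forall z, zeta z = f (0, z, 0).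
  apply: lincont_of_linear => [a x y|x].
    by rewrite -linearP; congr (f _); congr (_, _, _); rewrite /= scaler0 addr0.
  apply: continuous_comp; last exact: lincont_continuous.
  by do 2?apply: pair_continuous => ?;
    [exact: cvg_cst|exact: cvg_id|exact: cvg_cst].
exists xi, zeta, (f (0, 0, 1)) => x z m.
rewrite xiE zetaE -[m * _]/(m *: (f (0, 0, 1) : R^o)) -linearZ -!linearD.
congr (f _); congr (_, _, _) => /=.
- by rewrite scaler0 !addr0.
- by rewrite scaler0 addr0 add0r.
- by rewrite !add0r /GRing.scale/= mulr1.
Qed.

(** The sign of the coefficient tau comes from [W_up]: a negative tau would send
    the right-hand side to minus infinity along the ray above a feasible point. *)
Lemma separate_point x0 (m0 : R) : ~ W (x0, 0, m0) ->
  exists (xi : 'L(X, R^o)) (zeta : 'L(Z, R^o)) (tau e : R),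
  [/\ 0 < e, 0 <= tau & forall x z (m : R), W (x, z, m) ->
     (xi x0 : R) + m0 * tau + e <= (xi x : R) + (zeta z : R) + m * tau].
Proof.
move=> Wx0; have [f [e e0 fW]] := closed_convex_separation W_closed W_convex Wx0.
have [xi [zeta [tau fE]]] := triple_linear_split f.
have {}fW x z (m : R) : W (x, z, m) ->
    (xi x0 : R) + m0 * tau + e <= (xi x : R) + (zeta z : R) + m * tau.
  by move=> /fW; rewrite !fE linear0 addr0.
exists xi, zeta, tau, e; split => //; rewrite leNgt; apply/negP => tau0.
have [x [m Wxm]] := W_feasible.
pose D := xi x + m * tau - (xi x0 + m0 * tau).
have Nt : 0 < - tau by rewrite oppr_gt0.
have r0 : 0 <= `|D| / - tau by rewrite divr_ge0// ltW.
have := fW _ _ _ (W_up r0 Wxm).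
rewrite linear0 addr0 mulrDl.
have -> : `|D| / - tau * tau = - `|D| by field; rewrite lt_eqF.
have := ler_norm D; rewrite {1}/D; lra.
Qed.

(** Over a feasible x0, the point [(x0, 0, -1)] lies outside W on a vertical line
    that meets W, so a hyperplane that separates it from W is not vertical. *)
Lemma dual_set_nonempty : dual_set !=set0.
Proof.
have [x0 [m0 W0]] := W_feasible.
have m0_ge0 := W_ge0 W0.
have [|xi [zeta [tau [e [e0 tau0 h]]]]] := @separate_point x0 (-1).
  by move=> /W_ge0; rewrite oppr_ge0 leNgt ltr01.
have tau_gt0 : 0 < tau.
  rewrite lt_def tau0 andbT; apply/eqP => tau_eq0.
  by have := h _ _ _ W0; rewrite tau_eq0 linear0; lra.
exists (- (tau^-1 *: xi), - ((xi x0 : R) + - 1 * tau + e) / tau).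
exists (tau^-1 *: zeta) => x z m /h hx.
change (0 <= m + tau^-1 * (zeta z : R) - - (tau^-1 * (xi x : R))
  + - ((xi x0 : R) + - 1 * tau + e) / tau); rewrite opprK.
rewrite -(pmulr_rge0 _ tau_gt0) !mulrDr !mulrA mulfV ?gt_eqF// mul1r.
rewrite mulrAC mulfV ?gt_eqF//; lra.
Qed.

Lemma dual_set_up d (r : R) : 0 <= r -> dual_set d -> dual_set (d.1, d.2 + r).
Proof.
move=> r0 [zeta h]; exists zeta => x z m /h/=; lra.
Qed.

(** The reason is biconjugation at the single point [- x0]: the point
    [(- x0, 0, - a / 2)] is not in W, and a hyperplane that separates it from W,
    if not vertical, gives an element of [dual_set] with value [a / 2]. *)
Lemma dual_set_not_separated1 x0 (a : R) : 0 < a ->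
  ~ forall d, dual_set d -> a <= (d.1 x0 : R) + d.2.
Proof.
move=> a0 h.
have [|xi [zeta [tau [e [e0 tau_ge0 hW]]]]] := @separate_point (- x0) (- a / 2).
  by move=> /W_ge0; lra.
have [tau0|tau_neq0] := eqVneq tau 0.
  (* A vertical hyperplane gives a direction in which every element of the dual
     set can be moved, at a rate that drives the value to minus infinity. *)
  have [[xi1 b1] D1] := dual_set_nonempty.
  have DN (N : R) : 0 <= N ->
      dual_set (xi1 - N *: xi, b1 - N * (- (xi x0 : R) + e)).
    move=> N0; case: D1 => zeta1 h1; exists (zeta1 + N *: zeta) => x z m Wx.
    change (0 <= m + ((zeta1 z : R) + N * (zeta z : R))
      - ((xi1 x : R) - N * (xi x : R)) + (b1 - N * (- (xi x0 : R) + e))).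
    have /= h1x := h1 _ _ _ Wx; have := hW _ _ _ Wx.
    rewrite tau0 linearN !mulr0 !addr0 -subr_ge0 => /(mulr_ge0 N0) h2.
    by move: (addr_ge0 h1x h2); congr (_ <= _); ring.
  pose c : R := (xi1 x0 : R) + b1.
  have N0 : 0 <= `|c| / e by rewrite divr_ge0// ltW.
  have := h _ (DN _ N0).
  change (a <= ((xi1 x0 : R) - `|c| / e * (xi x0 : R))
    + (b1 - `|c| / e * (- (xi x0 : R) + e)) -> False).
  rewrite mulrDr mulfVK ?gt_eqF//.
  have := ler_norm c; rewrite {1}/c; lra.
have tau_gt0 : 0 < tau by rewrite lt_def tau_neq0.
have /h : dual_set (- (tau^-1 *: xi), a / 2 + tau^-1 * (xi x0 : R)).
  exists (tau^-1 *: zeta) => x z m /hW/= hx.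
  change (0 <= m + tau^-1 * (zeta z : R) - - (tau^-1 * (xi x : R))
    + (a / 2 + tau^-1 * (xi x0 : R))); rewrite opprK.
  rewrite -(pmulr_rge0 _ tau_gt0) !mulrDr !mulrA mulfV// !mul1r.
  by move: hx; rewrite linearN/=; lra.
change (a <= - (tau^-1 * (xi x0 : R)) + (a / 2 + tau^-1 * (xi x0 : R)) -> False); lra.
Qed.

(** No half-space of the form below separates the origin from [dual_set].  For
    [t < 0] this is because [dual_set] is closed upwards; [t > 0] is a rescaling
    of the case [t = 1]; and for [t = 0] a feasible point x1 provides the
    inequality [- m1 <= d.2 - d.1 x1], which allows perturbing t to a small
    positive s. *)
Lemma dual_set_not_separated x0 (t a : R) : 0 < a ->
  ~ forall d, dual_set d -> a <= (d.1 x0 : R) + t * d.2.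
Proof.
have pos y (s c : R) : 0 < s -> 0 < c ->
    ~ forall d, dual_set d -> c <= (d.1 y : R) + s * d.2.
  move=> s0 c0 h; apply: (@dual_set_not_separated1 (s^-1 *: y) (c / s)); first exact: divr_gt0.
  move=> d /h; rewrite linearZ/= -[_ *: _]/(s^-1 * (d.1 y : R)) => hd.
  rewrite ler_pdivrMr// mulrDl mulrAC mulVf ?gt_eqF// mul1r; lra.
move=> a0 h; have [t0|t0|t0] := ltgtP t 0; last 2 first.
- exact: (pos x0 t a).
- have [x1 [m1 W1]] := W_feasible; have m1_ge0 := W_ge0 W1.
  (* Small enough for the error term s * m1 to stay below a / 2. *)
  pose s := a / (2 * (m1 + 1)).
  have s0 : 0 < s by rewrite divr_gt0// mulr_gt0// ltr_wpDl.
  apply: (pos (x0 - s *: x1) s (a / 2)) => //; first exact: divr_gt0.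
  move=> d Dd; have := h d Dd; rewrite t0 mul0r addr0.
  case: Dd => zeta /(_ _ _ _ W1); rewrite linear0 addr0 => /(mulr_ge0 (ltW s0)).
  rewrite linearB linearZ/= -[_ *: _]/(s * (d.1 x1 : R)).
  have : s * m1 <= a / 2.
    rewrite /s mulrAC ler_pdivrMr ?mulr_gt0 ?ltr_wpDl//.
    have -> : a / 2 * (2 * (m1 + 1)) = a * m1 + a by field.
    by rewrite lerDl ltW.
  lra.
have [d Dd] := dual_set_nonempty.
have Nt : 0 < - t by rewrite oppr_gt0.
have r0 : 0 <= `|(d.1 x0 : R) + t * d.2| / - t by rewrite divr_ge0// ltW.
have := h _ (dual_set_up r0 Dd) => /=.
have -> : t * (d.2 + `|(d.1 x0 : R) + t * d.2| / - t) = t * d.2 - `|(d.1 x0 : R) + t * d.2|.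
  by field; rewrite lt_eqF.
have := ler_norm ((d.1 x0 : R) + t * d.2); lra.
Qed.

Lemma dual_set_convex d d' (a b : R) : 0 <= a -> 0 <= b -> a + b = 1 ->
  dual_set d -> dual_set d' ->
  dual_set (a *: d.1 + b *: d'.1, a * d.2 + b * d'.2).
Proof.
move=> a0 b0 ab [z h] [z' h']; exists (a *: z + b *: z') => x y m Wx.
have h1 := mulr_ge0 a0 (h _ _ _ Wx); have h2 := mulr_ge0 b0 (h' _ _ _ Wx).
change (0 <= m + (a * (z y : R) + b * (z' y : R))
  - (a * (d.1 x : R) + b * (d'.1 x : R)) + (a * d.2 + b * d'.2)).
have -> : m = (a + b) * m by rewrite ab mul1r.
by move: (addr_ge0 h1 h2); congr (_ <= _); ring.
Qed.

(** Only the values at the finitely many points of s matter, so the separation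
    can take place in a space of row vectors, where a linear functional is a
    combination of coordinates: applied to the values of xi at the points of s it
    is the evaluation of xi at a single point, and [dual_set_not_separated]
    applies. *)
Lemma dual_set_approx (s : seq X) (e : R) : 0 < e ->
  exists2 d, dual_set d & `|d.2| < e /\ forall x, x \in s -> `|d.1 x| < e.
Proof.
move=> e0; apply: contrapT => noD.
pose ev (d : 'L(X, R^o) * R) : 'rV[R]_(size s) * R^o :=
  (\row_j d.1 s`_j, d.2).
pose U := [set p : 'rV[R]_(size s) * R^o | (forall j, `|p.1 0 j| < e) /\ `|p.2| < e].
have Uconv : convex_set (U : set (convex_lmodType ('rV[R]_(size s) * R^o)%type)).
  have ball (a b x y : R) : 0 <= a -> 0 <= b -> a + b = 1 ->
      `|x| < e -> `|y| < e -> `|a * x + b * y| < e.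
    move=> a0 b0 ab xe ye; apply: le_lt_trans (ler_normD _ _) _.
    rewrite !normrM (ger0_norm a0) (ger0_norm b0).
    apply: (@le_lt_trans _ _ ((a + b) * Num.max `|x| `|y|)).
      by rewrite mulrDl lerD// ler_wpM2l// le_max lexx ?orbT.
    by rewrite ab mul1r gt_max xe ye.
  apply/convex_setP => a b x y a0 b0 ab [x1 x2] [y1 y2].
  by split=> [j|]; rewrite ?mxE; exact: ball.
have Uabs : absorbing U.
  move=> p.
  pose M := `|p.2| + \sum_j `|p.1 0 j|.
  have M0 : 0 <= M by rewrite addr_ge0// sumr_ge0.
  exists (e / (M + 1)); first by rewrite divr_gt0// ltr_wpDl.
  have small (c : R) : `|c| <= M -> `|e / (M + 1) * c| < e.
    move=> cM; rewrite normrM gtr0_norm ?divr_gt0 ?ltr_wpDl//.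
    rewrite mulrAC ltr_pdivrMr ?ltr_wpDl// ltr_pM2l//.
    by apply: le_lt_trans cM _; rewrite ltrDl.
  split=> [j|]; rewrite ?mxE; apply: small; last first.
    by rewrite lerDl sumr_ge0.
  by rewrite /M (bigD1 j)//= addrCA lerDl addr_ge0// sumr_ge0.
have [||||f [c c0 [fD _]]] := convex_strict_separation (W := ev @` dual_set) _ _ Uconv Uabs.
- by have [d Dd] := dual_set_nonempty; exists (ev d), d.
- apply/convex_setP => a b _ _ a0 b0 ab [d Dd <-] [d' Dd' <-].
  exists (a *: d.1 + b *: d'.1, a * d.2 + b * d'.2); first exact: dual_set_convex.
  by congr (_, _); apply/rowP => j; rewrite !mxE.
- by move=> u [u1 u2]; split=> [j|]; rewrite ?mxE normrN.
- move=> _ [d Dd <-] [h1 h2]; apply: noD; exists d => //; split=> // x xs.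
  have ixs : (index x s < size s)%N by rewrite index_mem.
  by have := h1 (Ordinal ixs); rewrite mxE/= nth_index.
pose E : lmodType R := ('rV[R]_(size s) * R^o)%type.
pose b (j : 'I_(size s)) : E := (delta_mx 0 j, 0).
have evE d : ev d = \sum_(j < size s) (d.1 s`_j : R) *: b j + d.2 *: ((0, 1) : E).
  apply: injective_projections.
    rewrite -[(_ + _).1]/(_.1 + _.1) (@big_morph _ _ (@fst _ _ : E -> _) 0 +%R 0 +%R)//=.
    rewrite scaler0 addr0 [LHS]row_sum_delta.
    by apply: eq_bigr => j _; rewrite mxE.
  rewrite -[(_ + _).2]/(_.2 + _.2) (@big_morph _ _ (@snd _ _ : E -> _) 0 +%R 0 +%R)//=.
  by rewrite big1 ?add0r => [|j _]; [rewrite /GRing.scale/= mulr1|rewrite scaler0].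
pose x0 : X := \sum_(j < size s) (f (b j) : R) *: s`_j.
apply: (@dual_set_not_separated x0 (f (0, 1)) c c0) => d Dd.
have := fD _ (imageP ev Dd); congr (_ <= _).
rewrite evE linearD !linear_sum/=; congr (_ + _).
  by apply: eq_bigr => j _; rewrite !linearZ; exact: mulrC.
by rewrite linearZ; exact: mulrC.
Qed.

End Perturbation.

(** * Interiors of cones and weak suprema *)

Section Cone.
Context (R : realType) (Y : tvsType R) (K : set Y).
Hypothesis K_convex : convex_set (K : set (convex_lmodType Y)).
Hypothesis K_cone : is_cone K.
Implicit Types (k y v : Y).

Lemma coneD k k' : K k -> K k' -> K (k + k').
Proof.
move/convex_setP : K_convex => Kc Kk Kk'.
have -> : k + k' = (2 : R) *: (2^-1 *: k + 2^-1 *: k').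
  by rewrite scalerDr !scalerA mulfV// !scale1r.
apply: K_cone => //; apply: Kc => //; rewrite ?invr_ge0//.
by rewrite -div1r -splitr.
Qed.

Lemma nbhs_line y v (A : set Y) : nbhs y A -> exists2 t : R, 0 < t & A (y + t *: v).
Proof.
move=> /(nbhsB (- y)); rewrite addNr => /nbhs0_absorbing/(_ v)[t t0 [w Aw wE]].
by exists t => //; rewrite -wE addrA subrr add0r.
Qed.

Lemma interior_coneD k k' : K k -> K° k' -> K° (k + k').
Proof.
move=> Kk /(nbhsB k); apply: filterS => _ [v Kv <-]; exact: coneD.
Qed.

Lemma interior_coneZ (t : R) k : 0 < t -> K° k -> K° (t *: k).
Proof.
move=> t0 /(nbhsZ (lt0r_neq0 t0)); apply: filterS => _ [v Kv <-].
by apply: K_cone => //; exact: ltW.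
Qed.

Lemma interior_cone_sub k : K° k -> K k.
Proof. exact: interior_subset. Qed.

Lemma interior_cone_big k0 y : K° k0 -> exists2 t : R, 0 < t & K° (y + t *: k0).
Proof.
move=> Kk0.
have [t t0 Kt] := nbhs_line y (open_nbhs_nbhs (conj (@open_interior _ K) Kk0)).
exists t^-1; first by rewrite invr_gt0.
have := interior_coneZ (t := t^-1) _ Kt; rewrite invr_gt0 => /(_ t0).
by rewrite scalerDr scalerA mulVf ?gt_eqF// scale1r addrC.
Qed.

Lemma interior_cone_room k0 k : K° k -> exists2 t : R, 0 < t & K° (k - t *: k0).
Proof.
move=> Kk.
have [t t0 Kt] := nbhs_line (- k0) (open_nbhs_nbhs (conj (@open_interior _ K) Kk)).
by exists t => //; rewrite -scalerN.
Qed.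

Lemma wltE (u v : Y) : wlt K u%:E v%:E <-> K° (v - u).
Proof.
split=> [[k Kk kE]|Kk]; first by rewrite -opprB -kE opprK.
by exists (v - u) => //; rewrite opprB.
Qed.

(** Descend from y in the direction - k0 as long as no element of M is above.  The
    descent is bounded because the ray ends up below m0.  Since K° is open, the
    limit point is still not below any element of M, and whatever lies strictly
    below it also lies below a point slightly further down the ray, hence below
    an element of M. *)
Lemma WSup_ray (M : set (\bar Y)) k0 m0 y : K° k0 -> M m0%:E ->
  (forall m, M m -> ~ wlt K y%:E m) ->
  exists2 t : R, 0 <= t & WSup K M (y - t *: k0)%:E.
Proof.
move=> Kk0 Mm0 yM.
pose A := [set t : R | forall m, M m -> ~ wlt K (y - t *: k0)%:E m].
have A0 : A 0 by move=> m; rewrite scale0r subr0; exact: yM.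
have A_down s t : s <= t -> A t -> A s.
  move=> st At [m||] Mm; [|exact: (At +oo%E Mm)|by []].
  move=> /wltE sm; apply: (At m%:E Mm); apply/wltE.
  have -> : m - (y - t *: k0) = (t - s) *: k0 + (m - (y - s *: k0)).
    by rewrite !opprB scalerBl [in RHS](addrCA m) [RHS]addrA subrK addrCA.
  by apply: interior_coneD => //; apply: K_cone; rewrite ?subr_ge0//; exact: interior_cone_sub.
have A_bounded : has_sup A.
  split; first by exists 0.
  have [t t0 Kt] := interior_cone_big (m0 - y) Kk0.
  exists t => s As; rewrite leNgt; apply/negP => /ltW ts.
  apply: (A_down _ _ ts As m0%:E Mm0); apply/wltE.
  by rewrite opprB addrCA addrC.
have sup_ge0 : 0 <= sup A by apply: ub_le_sup => //; exact: A_bounded.2.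
exists (sup A) => //; split=> [[m||] Mm|].
- move=> /wltE /(interior_cone_room k0)[t t0 Kt].
  have [a Aa ta] := sup_adherent t0 A_bounded.
  apply: (A_down _ _ (ltW ta) Aa m%:E Mm); apply/wltE.
  by move: Kt; rewrite !opprB scalerBl [in X in _ -> X]addrAC [in X in _ -> X]addrA.
- exact: (A0 _ Mm).
- by [].
move=> [v| |] //.
- move=> /wltE /(interior_cone_room k0)[t t0 Kt].
  have /existsNP[m /not_implyP[Mm /contrapT]] : ~ A (sup A + t).
    by move=> /(ub_le_sup A_bounded.2); rewrite gerDl leNgt t0.
  case: m Mm => [m| |] Mm; last by [].
    move=> /wltE Km; exists m%:E => //; apply/wltE.
    have -> : m - v = (y - sup A *: k0 - v - t *: k0) + (m - (y - (sup A + t) *: k0)).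
      rewrite [y - _ - v - _]addrAC -[y - _ - _]addrA -opprD -scalerDl.
      by rewrite [RHS]addrC addrA subrK.
    by apply: interior_coneD => //; exact: interior_cone_sub.
  by move=> _; exists +oo%E.
- by move=> _; exists m0%:E.
Qed.

End Cone.

(** * Conjugates and the primal and dual bounds *)

Section Conjugates.
Context (R : realType) (X Y : tvsType R) (K : set Y).
Hypothesis K_convex : convex_set (K : set (convex_lmodType Y)).
Hypothesis K_cone : is_cone K.
Hypothesis K_int : K° !=set0.

(** The epigraph of a conjugate is described by inequalities alone: descending
    from a y that satisfies them, [WSup_ray] reaches the weak supremum. *)
Lemma sepi_conjugateP (P : X -> \bar Y) (L : 'L(X, Y)) (y : Y) :
  (forall x, P x <> -oo%E) -> (exists x w, P x = w%:E) ->
  sepi K (conjugate K P) (L, y) <->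
  forall x w, P x = w%:E -> ~ K° (L x - w - y).
Proof.
move=> PNoo [x0 [w0 Px0]]; split.
  case=> -[v| |] [vL _] [k Kk] //= -[yE] x w Pxw Kxw.
  apply: (vL (L x - w)%:E); first by exists x => //; rewrite Pxw.
  apply/wltE; have -> : L x - w - v = k + (L x - w - y).
    by rewrite yE opprD [RHS]addrC [in RHS]addrA subrK.
  exact: interior_coneD.
move=> yL; have [k0 Kk0] := K_int.
pose M := range (fun x => (L x)%:E - P x)%E.
have [||t t0 Wt] := @WSup_ray _ _ _ K_convex K_cone M k0 (L x0 - w0) y Kk0.
- by exists x0 => //; rewrite Px0.
- move=> _ [x _ <-]; case Px : (P x) => [w||] //; last by case: (PNoo x).
  by move=> /wltE; exact: yL.
exists (y - t *: k0)%:E => //; exists (t *: k0); last first.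
  by rewrite -[RHS]/(y - t *: k0 + t *: k0)%:E subrK.
by apply: K_cone => //; exact: interior_cone_sub.
Qed.

End Conjugates.

Section Farkas.
Context (R : realType) (X Y Z : tvsType R) (K : set Y) (S : set Z) (C : set X).
Variables (F : X -> \bar Y) (G : X -> \bar Z).
Hypothesis K_convex : convex_set (K : set (convex_lmodType Y)).
Hypothesis K_cone : is_cone K.
Hypothesis K_int : K° !=set0.
Hypothesis FNoo : forall x, F x <> -oo%E.
Hypothesis GNoo : forall x, G x <> -oo%E.
Hypothesis feasible : exists x f g, [/\ C x, F x = f%:E & G x = g%:E].

Definition primal_bound (L : 'L(X, Y)) (y : Y) := forall x f s,
  C x -> S s -> F x = f%:E -> G x = (- s)%:E -> ~ K° (L x - f - y).

Definition dual_bound_by (T : 'L(Z, Y)) (L : 'L(X, Y)) (y : Y) :=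
  forall x f g s, C x -> S s -> F x = f%:E -> G x = g%:E ->
    ~ K° (T (- s) - (f + T g - L x + y)).

Lemma primal_boundP (L : 'L(X, Y)) y :
  (forall x, C x -> (EFin @` (-%R @` S)) (G x) ->
     ~ (EFin @` (-%R @` K°)) (F x - (L x)%:E + y%:E)%E) <-> primal_bound L y.
Proof.
split=> [h x f s Cx Ss Fx Gx Kx|h x Cx [_ [s Ss <-] Gx] [_ [k Kk <-]]].
  apply: (h x Cx); first by rewrite Gx; exists (- s) => //; exists s.
  rewrite Fx; exists (f - L x + y) => //; exists (L x - f - y) => //.
  by rewrite !opprB addrC.
case Fx : (F x) => [f| |] // -[kE].
apply: (h x f s) => //; suff -> : L x - f - y = k by [].
by rewrite -[k]opprK kE opprD opprB.
Qed.

Lemma dual_bound_byP (T : 'L(Z, Y)) (L : 'L(X, Y)) y :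
  (forall x, C x ->
     ~ (EFin @` [set (u - k)%R | u in T @` (-%R @` S) & k in K°])
         (F x + er_map T (G x) - (L x)%:E + y%:E)%E) <-> dual_bound_by T L y.
Proof.
split=> [h x f g s Cx Ss Fx Gx Kx|h x Cx].
  apply: (h x Cx); rewrite Fx Gx; exists (f + T g - L x + y) => //.
  exists (T (- s)); first by exists (- s) => //; exists s.
  by exists (T (- s) - (f + T g - L x + y)) => //; rewrite subKr.
case Fx : (F x) => [f| |]; case Gx : (G x) => [g| |] //=; try by case=> ? _.
move=> [_ [_ [_ [s Ss <-] <-] [k Kk <-]] [kE]].
by apply: (h x f g s) => //; rewrite -kE subKr.
Qed.

(** A set and its weak supremum have the same points strictly below them.  The
    positivity of T enters by making T(-S) bounded above in the weak sense: no
    point of the interior of K is below any element of T(-S), so a descent that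
    starts high above a stops at a weak supremum. *)
Lemma conjugate_indicator_interior (T : 'L(Z, Y)) (a : Y) : Lplus_w S K T ->
  (exists2 v, conjugate K (indicator (-%R @` S)) T v%:E & K° (v - a)) <->
  (exists2 s, S s & K° (T (- s) - a)).
Proof.
move=> TS; have [k0 Kk0] := K_int.
pose M := range (fun z => (T z)%:E - indicator (R := R) (X := Z) (Y := Y) (-%R @` S) z)%E.
have MP m : M m -> m = -oo%E \/ exists2 s, S s & m = (T (- s))%:E.
  move=> [z _ <-]; rewrite /indicator; case: ifPn; last by left.
  by rewrite inE => -[s Ss <-]; right; exists s => //=; rewrite oppr0 addr0.
have PM s : S s -> M (T (- s))%:E.
  move=> Ss; exists (- s) => //; rewrite /indicator mem_set; last by exists s.
  by rewrite /= oppr0 addr0.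
split=> [[v [_ vM] Kv]|[s Ss Ks]].
  have [m /MP[->//|[s Ss ->]] /wltE Ks] := vM a%:E ((wltE _ _ _).2 Kv).
  by exists s.
have [t t0 Kt] := interior_cone_big K_cone a Kk0.
have [||r r0 Wr] := @WSup_ray _ _ _ K_convex K_cone M k0 (T (- s)) (a + t *: k0) Kk0.
- exact: PM.
- move=> m /MP[->//|[s' Ss' ->]] /wltE K's.
  have : ((T @` S) `&` (-%R @` K°)) (T s').
    split; first by exists s'.
    exists (a + t *: k0 + (T (- s') - (a + t *: k0))).
      by apply: interior_coneD => //; exact: interior_cone_sub.
    by rewrite addrC subrK linearN opprK.
  by rewrite TS.
exists (a + t *: k0 - r *: k0) => //.
have -> : a + t *: k0 - r *: k0 - a = (t - r) *: k0.
  by rewrite addrAC [a + _]addrC addrK -scalerBl.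
apply: interior_coneZ => //; rewrite subr_gt0 ltNge; apply/negP => tr.
apply: (Wr.1 _ (PM s Ss)); apply/wltE.
have -> : T (- s) - (a + t *: k0 - r *: k0) = (r - t) *: k0 + (T (- s) - a).
  by rewrite -[a + _ - _]addrA opprD opprB addrA scalerBl [RHS]addrC.
apply: interior_coneD => //; apply: K_cone; first by rewrite subr_ge0.
exact: interior_cone_sub.
Qed.

(** Intersecting over the weak suprema v of T(-S) amounts to letting -s range
    over -S, by [conjugate_indicator_interior]. *)
Lemma bigcap_epi_conjugateP (T : 'L(Z, Y)) (L : 'L(X, Y)) y : Lplus_w S K T ->
  (\bigcap_(v in [set v : Y | conjugate K (indicator (-%R @` S)) T v%:E])
     [set (p + ((0 : 'L(X, Y)), v))%R |
        p in sepi K (conjugate K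
          (fun x => F x + indicator C x + er_map T (G x))%E)]) (L, y) <->
  dual_bound_by T L y.
Proof.
move=> TS; pose P (x : X) := (F x + indicator C x + er_map T (G x))%E.
have PNoo x : P x <> -oo%E.
  rewrite /P /indicator; have := @FNoo x; have := @GNoo x.
  by case: (F x) (G x) => [f| |] [g| |] //; case: ifP.
have Pfin : exists x w, P x = w%:E.
  have [x [f [g [Cx Fx Gx]]]] := feasible.
  by exists x, (f + 0 + T g); rewrite /P Fx Gx /indicator mem_set.
have PE x w : P x = w%:E -> exists f g,
    [/\ C x, F x = f%:E, G x = g%:E & w = f + T g].
  rewrite /P /indicator; case: ifPn => Cx; last by case: (F x) (G x) => [f| |] [g| |].
  case: (F x) (G x) => [f| |] [g| |] //= -[<-]; exists f, g.
  by rewrite addr0; split=> //; exact: set_mem.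
have E (v : Y) (w x : Y) : x - w - (y - v) = v - (w - x + y).
  by rewrite opprB addrCA opprD opprB.
split=> [h x f g s Cx Ss Fx Gx Ks|h v Tv].
  have [v Tv Kv] := (conjugate_indicator_interior _ TS).2 (ex_intro2 _ _ s Ss Ks).
  have [[L' y'] Ly' [LE yE]] := h v Tv.
  have {}Ly' : sepi K (conjugate K P) (L, y - v).
    by rewrite -LE -yE addr0 addrK.
  apply: ((sepi_conjugateP K_convex K_cone K_int L _ PNoo Pfin).1 Ly' x (f + T g)).
    by rewrite /P Fx Gx /indicator mem_set//= addr0.
  by rewrite E.
exists (L, y - v).
  apply/(sepi_conjugateP K_convex K_cone K_int L _ PNoo Pfin) => x w /PE[f [g [Cx Fx Gx ->]]].
  rewrite E => Kv.
  have [s Ss Ks] := (conjugate_indicator_interior _ TS).1 (ex_intro2 _ _ v Tv Kv).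
  exact: (h x f g s).
by congr (_, _); rewrite /= ?addr0 ?subrK.
Qed.

Lemma dual_bound_by_primal (T : 'L(Z, Y)) (L : 'L(X, Y)) y :
  dual_bound_by T L y -> primal_bound L y.
Proof.
move=> h x f s Cx Ss Fx Gx Kx; apply: (h x f (- s) s) => //.
suff -> : T (- s) - (f + T (- s) - L x + y) = L x - f - y by [].
by rewrite [f + _]addrC -!addrA opprD [LHS]addrA subrr add0r !opprD opprK addrCA.
Qed.

End Farkas.

(** * Operators and the topology of pointwise convergence *)

Section PointwiseTopology.
Context (R : realType) (X Y : tvsType R).

Lemma eval_continuous (x : X) : continuous (fun L : 'L(X, Y) => L x).
Proof.
move=> L.
apply: (@continuous_comp _ _ _ (@lincont_fun R X Y : 'L(X, Y) -> {ptws X -> Y})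
  (fun f : {ptws X -> Y} => f x)).
  exact: initial_continuous.
exact: (@proj_continuous _ (fun _ => Y) x).
Qed.

Lemma nbhs_pointwise (L : 'L(X, Y)) A : nbhs L A ->
  exists (s : seq X) (U : set Y), nbhs 0 U /\
    forall L' : 'L(X, Y), (forall x, x \in s -> U (L' x - L x)) -> A L'.
Proof.
rewrite nbhsE => -[N [[B Bo BN] LN] NA].
(* The sets that contain a basic neighbourhood form a filter that converges
   to L at each point, hence in the product topology. *)
pose Fil : set_system (X -> Y) := [set D | exists (s : seq X) (U : set Y),
  nbhs 0 U /\ forall f, (forall x, x \in s -> U (f x - L x)) -> D f].
have FF : Filter Fil.
  split.
  - by exists [::], setT; split=> //; exact: filterT.
  - move=> D E [s [U [U0 sD]]] [t [V [V0 tE]]].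
    exists (s ++ t), (U `&` V); split; first exact: filterI.
    move=> f fst; split; [apply: sD|apply: tE] => x xs.
      by have [] := fst x; rewrite // mem_cat xs.
    by have [] := fst x; rewrite // mem_cat xs orbT.
  - by move=> D E DE [s [U [U0 sD]]]; exists s, U; split=> // f /sD /DE.
have : {ptws, Fil --> (L : X -> Y)}.
  apply/pointwise_cvgP => x A' A'x; exists [:: x], [set y | A' (y + L x)]; split.
    have /(nbhsB (- L x)) : nbhs (L x) A' by [].
    by rewrite addNr; apply: filterS => _ [v A'v <-] /=; rewrite addrAC addNr add0r.
  by move=> f /(_ x); rewrite mem_head /= subrK; apply.
move=> /(_ B) []; first by apply: open_nbhs_nbhs; split => //; rewrite -BN in LN.
move=> s [U [U0 sB]]; exists s, U; split=> // L' /sB BL'.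
by apply: NA; rewrite -BN.
Qed.

Lemma rank_one (f : 'L(X, R^o)) (k : Y) :
  exists g : 'L(X, Y), forall x, g x = f x *: k.
Proof.
apply: lincont_of_linear => [a x y|x]; first by rewrite linearP scalerDl scalerA.
apply: (@continuous_comp _ _ _ (fun x => (f x : R^o, k))
  (fun z : R^o * Y => z.1 *: z.2)); last exact: scale_continuous.
by apply: pair_continuous => ?; [exact: lincont_continuous|exact: cvg_cst].
Qed.

End PointwiseTopology.

(** * The primal bounds are the limits of the dual bounds *)

Section Epigraphs.
Context (R : realType) (X Y : tvsType R).

Lemma lsc_sublevel_closed (T : topologicalType) (f : X -> \bar R)
    (g : T -> X) (h : T -> R) :
  lower_semicontinuous f -> continuous g -> continuous h ->
  closed [set t | (f (g t) <= (h t)%:E)%E].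
Proof.
move=> fl gc hc; rewrite -openC openE => t /= /negP; rewrite -ltNge => ht.
have [a [ha af]] : exists a, h t < a /\ (a%:E < f (g t))%E.
  case: (f (g t)) ht => [r| |] //=.
    rewrite lte_fin => hr; exists ((h t + r) / 2).
    by rewrite lte_fin !midf_lt.
  by move=> _; exists (h t + 1); rewrite ltrDl ltry.
have [V Vg Vf] := fl _ _ af.
have Vt : nbhs t (g @^-1` V) by exact: gc.
have ht' : nbhs t (h @^-1` [set r | r < a]).
  by apply: hc; exact: lt_nbhsl.
apply: filterS (filterI Vt ht') => u [/Vf /= au /= hu]; apply/negP.
by rewrite -ltNge; apply: lt_trans au; rewrite lte_fin.
Qed.

Lemma epiP (K : set Y) (F : X -> \bar Y) p : epi K F p <->
  exists f k, [/\ F p.1 = f%:E, K k & p.2 = f + k].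
Proof.
split=> [[_ -> [k Kk]]|[f [k [Fx Kk yE]]]].
  by case: (F p.1) => [f| |] // [yE]; exists f, k.
by exists f%:E => //; exists k => //; rewrite yE.
Qed.

Lemma epi_comb (K : set Y) (F : X -> \bar Y) (a b : R) x x' y y' :
  Kconvex K F -> 0 <= a -> 0 <= b -> a + b = 1 ->
  epi K F (x, y) -> epi K F (x', y') ->
  epi K F (a *: x + b *: x', a *: y + b *: y').
Proof.
by move=> /convex_setP Fc a0 b0 ab xy xy'; exact: (Fc a b _ _ a0 b0 ab xy xy').
Qed.

Lemma Kconvex_comb (K : set Y) (F : X -> \bar Y) (a b : R) x x' f f' :
  K 0 -> Kconvex K F -> 0 <= a -> 0 <= b -> a + b = 1 ->
  F x = f%:E -> F x' = f'%:E -> exists g k,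
    [/\ F (a *: x + b *: x') = g%:E, K k & a *: f + b *: f' = g + k].
Proof.
move=> K0 Fc a0 b0 ab Fx Fx'; apply/(epiP K F (_, _)).
by apply: epi_comb => //; apply/epiP;
  [exists f, 0; rewrite addr0|exists f', 0; rewrite addr0].
Qed.

End Epigraphs.

Lemma affine_ge0_at0 (R : realFieldType) (c d : R) :
  (forall t, 0 < t -> 0 <= c + t * d) -> 0 <= c.
Proof.
move=> h; rewrite leNgt; apply/negP => c0.
have d1 : 0 < `|d| + 1 by rewrite ltr_wpDl.
have /h : 0 < - c / (`|d| + 1) by rewrite divr_gt0// oppr_gt0.
apply/negP; rewrite -ltNge -ltrBrDl sub0r mulrAC ltr_pdivrMr//.
by rewrite ltr_pM2l ?oppr_gt0//; apply: le_lt_trans (ler_norm d) _; rewrite ltrDl.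
Qed.

Lemma affine_ge0_slope (R : realFieldType) (c d : R) :
  (forall t, 0 < t -> 0 <= c + t * d) -> 0 <= d.
Proof.
move=> h; rewrite leNgt; apply/negP => d0.
have /h : 0 < (`|c| + 1) / - d by rewrite divr_gt0 ?ltr_wpDl// oppr_gt0.
have -> : (`|c| + 1) / - d * d = - (`|c| + 1) by field; rewrite lt_eqF.
by have := ler_norm c; lra.
Qed.

Section Approximation_of_primal_bounds.
Context (R : realType) (X Y Z : tvsType R) (K : set Y) (S : set Z) (C : set X).
Variables (F : X -> \bar Y) (G : X -> \bar Z).
Hypothesis K_convex : convex_set (K : set (convex_lmodType Y)).
Hypothesis K_cone : is_cone K.
Hypothesis K_int : K° !=set0.
Hypothesis S_neq0 : S !=set0.
Hypothesis S_convex : convex_set (S : set (convex_lmodType Z)).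
Hypothesis S_cone : is_cone S.
Hypothesis C_closed : closed C.
Hypothesis C_convex : convex_set (C : set (convex_lmodType X)).
Hypothesis F_convex : Kconvex K F.
Hypothesis F_lsc : forall ystar : 'L(Y, R^o),
  lower_semicontinuous (er_map ystar \o F : X -> \bar R).
Hypothesis G_convex : Kconvex S G.
Hypothesis G_closed : epi_closed S G.
Hypothesis FNoo : forall x, F x <> -oo%E.
Hypothesis feasible : exists x f s,
  [/\ C x, S s, F x = f%:E & G x = (- s)%:E].

Let cone0 (V : tvsType R) (A : set V) : is_cone A -> A !=set0 -> A 0.
Proof. by move=> Ac [v Av]; rewrite -(scale0r v); exact: Ac. Qed.

Let S0 : S 0. Proof. exact: cone0. Qed.

Let K0 : K 0.
Proof. by apply: cone0 => //; have [k /interior_subset] := K_int; exists k. Qed.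

Lemma primal_bound_closed :
  closed [set p : 'L(X, Y) * Y | primal_bound K S C F G p.1 p.2].
Proof.
pose D := [set i : X * Y * Z |
  [/\ C i.1.1, S i.2, F i.1.1 = i.1.2%:E & G i.1.1 = (- i.2)%:E]].
pose val (i : X * Y * Z) (p : 'L(X, Y) * Y) := p.1 i.1.1 - i.1.2 - p.2.
have -> : [set p : 'L(X, Y) * Y | primal_bound K S C F G p.1 p.2] =
    \bigcap_(i in D) val i @^-1` (~` K°).
  apply/seteqP; split=> [p pb [[x f] s] [Cx Ss Fx Gx] /=|p h x f s Cx Ss Fx Gx].
    exact: (pb x f s).
  by apply: (h (x, f, s)).
apply: closed_bigI => i _; apply: closed_comp => [p _|]; last first.
  by rewrite closedC; exact: open_interior.
apply: (@continuous_comp _ _ _ (fun p : 'L(X, Y) * Y => (p.1 i.1.1 - i.1.2, p.2))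
  (fun z : Y * Y => z.1 - z.2)); last exact: sub_continuous.
apply: pair_continuous => q; last exact: cvg_snd.
apply: (@continuous_comp _ _ _ (fun p : 'L(X, Y) * Y => (p.1 i.1.1, i.1.2))
  (fun z : Y * Y => z.1 - z.2)); last exact: sub_continuous.
apply: pair_continuous => r; last exact: cvg_cst.
apply: (@continuous_comp _ _ _ fst (fun L : 'L(X, Y) => L i.1.1)); first exact: cvg_fst.
exact: eval_continuous.
Qed.

(** The values of F - L + y at feasible points, enlarged by the interior of K,
    form an open convex set, which the primal bound keeps away from the origin;
    a functional that separates the two is nonnegative on K and positive on its
    interior. *)
Lemma scalarize (L : 'L(X, Y)) (y : Y) : primal_bound K S C F G L y ->
  exists phi : 'L(Y, R^o), [/\ forall k, K k -> 0 <= phi k :> R,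
    forall k, K° k -> 0 < phi k :> R &
    forall x f s, C x -> S s -> F x = f%:E -> G x = (- s)%:E ->
      (phi (L x) : R) <= (phi f : R) + (phi y : R)].
Proof.
move=> pb; have [k0 Kk0] := K_int.
pose A := [set v : Y | exists x f s,
  [/\ C x, S s, F x = f%:E, G x = (- s)%:E & v = f - L x + y]].
pose P := [set a + k | a in A & k in K°].
have P_open : open P.
  rewrite openE => _ [a Aa [k Kk <-]].
  have := nbhsB a (open_nbhs_nbhs (conj (@open_interior _ K) Kk)).
  by apply: filterS => _ [v Kv <-]; exists a => //; exists v.
have P_convex : convex_set (P : set (convex_lmodType Y)).
  apply/convex_setP => a b _ _ a0 b0 ab
    [_ [x [f [s [Cx Ss Fx Gx ->]]]] [k Kk <-]]
    [_ [x' [f' [s' [Cx' Ss' Fx' Gx' ->]]]] [k' Kk' <-]].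
  have [f2 [k2 [F2 Kk2 f2E]]] := Kconvex_comb K0 F_convex a0 b0 ab Fx Fx'.
  have [g2 [s2 [G2 Ss2 g2E]]] := Kconvex_comb S0 G_convex a0 b0 ab Gx Gx'.
  (* The excess k2 produced by the convexity of F is absorbed by K°. *)
  exists (f2 - L (a *: x + b *: x') + y).
    exists (a *: x + b *: x'), f2, (a *: s + b *: s' + s2); split=> //.
    - by move/convex_setP : C_convex; apply.
    - by do 2?apply: coneD => //; exact: S_cone.
    - by rewrite G2; congr EFin; rewrite 2!opprD -[LHS](addrK s2) -g2E !scalerN.
  exists (k2 + (a *: k + b *: k')).
    apply: interior_coneD => //.
    have [a_eq0|a_neq0] := eqVneq a 0.
      have b1 : b = 1 by rewrite -ab a_eq0 add0r.
      by rewrite a_eq0 b1 scale0r scale1r add0r.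
    rewrite addrC; apply: interior_coneD => //.
      by apply: K_cone => //; exact: interior_subset.
    by apply: interior_coneZ => //; rewrite lt_def a_neq0.
  rewrite !scalerDr [RHS]addrACA [in RHS](addrACA _ (a *: y)) -scalerDl ab scale1r.
  rewrite [in RHS](addrACA (a *: f)) f2E !scalerN -opprD.
  have <- : L (a *: x + b *: x') = a *: L x + b *: L x' by rewrite linearD !linearZ.
  by rewrite [LHS]addrA [in LHS](addrAC _ y) [in LHS](addrAC _ _ k2).
have P0 : ~ P 0.
  move=> [_ [x [f [s [Cx Ss Fx Gx ->]]]] [k Kk kE]].
  apply: (pb x f s) => //; suff -> : L x - f - y = k by [].
  have -> : k = - (f - L x + y) by apply/eqP; rewrite -addr_eq0 addrC kE.
  by rewrite opprD opprB.
have [x0 [f0 [s0 [Cx0 Ss0 Fx0 Gx0]]]] := feasible.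
have A0 : A (f0 - L x0 + y) by exists x0, f0, s0.
have [|phi phiP] := open_convex_separation P_open _ P_convex P0.
  by exists (f0 - L x0 + y + k0), (f0 - L x0 + y) => //; exists k0.
have phi_int0 k : K° k -> 0 <= phi k :> R.
  move=> Kk; apply: (@affine_ge0_slope _ (phi (f0 - L x0 + y))) => t t0.
  rewrite -[t * _]/(t *: phi k) -linearZ -linearD ltW//; apply: phiP.
  by exists (f0 - L x0 + y) => //; exists (t *: k) => //; exact: interior_coneZ.
exists phi; split=> [k Kk|k Kk|x f s Cx Ss Fx Gx].
- apply: (@affine_ge0_at0 _ _ (phi k0)) => t t0.
  rewrite -[t * _]/(t *: phi k0) -linearZ -linearD; apply: phi_int0.
  by apply: interior_coneD => //; exact: interior_coneZ.
- have Pv : P (f0 - L x0 + y + k0) by exists (f0 - L x0 + y) => //; exists k0.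
  have [t t0 Kt] := interior_cone_room (f0 - L x0 + y + k0) Kk.
  have := phi_int0 _ Kt; rewrite linearB linearZ subr_ge0.
  by apply: lt_le_trans; rewrite pmulr_rgt0//; exact: phiP.
have : 0 <= phi (f - L x + y) :> R.
  apply: (@affine_ge0_at0 _ _ (phi k0)) => t t0.
  rewrite -[t * _]/(t *: phi k0) -linearZ -linearD; apply/ltW/phiP.
  exists (f - L x + y); first by exists x, f, s.
  by exists (t *: k0) => //; exact: interior_coneZ.
by rewrite linearD linearB addrAC subr_ge0.
Qed.

(** After scalarization by phi the primal bound says that the convex function
    phi o (F - L + y) is nonnegative on the feasible set, and [dual_set_approx]
    perturbs that function slightly so that it has a multiplier zeta.  Both the
    multiplier and the perturbation become vector-valued by multiplication with
    a k0 in the interior of K on which phi is 1; then phi gives back the scalar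
    inequality, which contradicts any violation of the vector one. *)
Lemma primal_bound_approx (L : 'L(X, Y)) (y : Y) : primal_bound K S C F G L y ->
  closure [set p : 'L(X, Y) * Y | exists2 T, Lplus_w S K T &
    dual_bound_by K S C F G T p.1 p.2] (L, y).
Proof.
move=> /scalarize[phi [phiK phi_int phi_pb]].
have [k0 [Kk0 phik0]] : exists k0, K° k0 /\ phi k0 = 1 :> R.
  have [k Kk] := K_int; have phik := phi_int _ Kk.
  exists ((phi k : R)^-1 *: k); split; first by apply: interior_coneZ => //; rewrite invr_gt0.
  by rewrite linearZ; exact: mulVf (lt0r_neq0 phik).
(* The constraint is relaxed to z being in G x + S.  This W is closed because the
   epigraph of G is, although zeta o G need not be lower semicontinuous for a
   positive zeta. *)
pose h (u : X * Z * R^o) : R := u.2 + (phi (L u.1.1) : R) - (phi y : R).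
pose W := [set u : X * Z * R^o | C u.1.1] `&` [set u | epi S G u.1] `&`
  [set u | (er_map phi (F u.1.1) <= (h u)%:E)%E].
have WP x z m : W (x, z, m) <-> C x /\ epi S G (x, z) /\
    exists2 f, F x = f%:E & (phi f : R) <= m + (phi (L x) : R) - (phi y : R).
  rewrite /W /h /=; split=> [[[Cx Gx]]|[Cx [Gx [f -> hf]]]]; last by rewrite /= lee_fin.
  case Fx : (F x) => [f| |] //=; last by case: (FNoo Fx).
  by rewrite lee_fin => hf; do 2?split => //; exists f.
have fst2 : continuous (fun u : X * Z * R^o => u.1.1).
  by move=> u; apply: continuous_comp; exact: cvg_fst.
have W_closed : closed W.
  apply: closedI; first apply: closedI.
  - by apply: closed_comp => // u _; exact: fst2.
  - by apply: closed_comp => // u _; exact: cvg_fst.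
  apply: (@lsc_sublevel_closed _ _ _ (er_map phi \o F) _ h (F_lsc (ystar := phi)) fst2) => u.
  apply: cvgB; last exact: cvg_cst.
  apply: cvgD; first exact: cvg_snd.
  apply: (@continuous_comp _ _ _ (fun v : X * Z * R^o => L v.1.1) phi).
    by apply: (@continuous_comp _ _ _ (fun v : X * Z * R^o => v.1.1) L);
      [exact: fst2|exact: lincont_continuous].
  exact: lincont_continuous.
have W_convex : convex_set (W : set (convex_lmodType (X * Z * R^o)%type)).
  apply/convex_setP => a b0 [[x z] m] [[x' z'] m'] a_ge0 b_ge0 ab
    /WP[Cx [Gx [f Fx hf]]] /WP[Cx' [Gx' [f' Fx' hf']]].
  apply/WP; split; first by move/convex_setP : C_convex; apply.
  split; first exact: epi_comb.
  have [f2 [k2 [F2 Kk2 f2E]]] := Kconvex_comb K0 F_convex a_ge0 b_ge0 ab Fx Fx'.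
  exists f2 => //.
  have := congr1 (fun v => phi v : R) f2E; rewrite !linearD !linearZ/=.
  change (a * (phi f : R) + b0 * (phi f' : R) = (phi f2 : R) + (phi k2 : R) ->
    (phi f2 : R) <= a * m + b0 * m' +
      (a * (phi (L x) : R) + b0 * (phi (L x') : R)) - (phi y : R)).
  have aux (p p' q r c c' l l' d : R) : p <= c + l - d -> p' <= c' + l' - d ->
      0 <= r -> a * p + b0 * p' = q + r ->
      q <= a * c + b0 * c' + (a * l + b0 * l') - d.
    move=> /(ler_wpM2l a_ge0) h1 /(ler_wpM2l b_ge0) h2 r0 e1.
    have -> : d = (a + b0) * d by rewrite ab mul1r.
    lra.
  by apply: aux => //; exact: phiK.
have W_up x z (m r : R) : 0 <= r -> W (x, z, m) -> W (x, z, m + r).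
  move=> r0 /WP[Cx [Gx [f Fx hf]]]; apply/WP; do 2?split => //; exists f => //.
  by apply: le_trans hf _; rewrite -!addrA lerD2l lerDr.
have W_ge0 x (m : R) : W (x, 0, m) -> 0 <= m.
  move=> /WP[Cx [/epiP[g [s [/= Gx Ss gs0]]] [f Fx hf]]].
  move/esym/eqP : gs0; rewrite addr_eq0 => /eqP gs; rewrite gs in Gx.
  have aux (p l c : R) : p <= m + l - c -> l <= p + c -> 0 <= m by lra.
  exact: aux hf (phi_pb _ _ _ Cx Ss Fx Gx).
have [x0 [f0 [s0 [Cx0 Ss0 Fx0 Gx0]]]] := feasible.
have W_feas : exists x (m : R), W (x, 0, m).
  exists x0, ((phi f0 : R) - (phi (L x0) : R) + (phi y : R)).
  apply/WP; do 2?split=> //; last by exists f0 => //; lra.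
  by apply/epiP; exists (- s0), s0; rewrite addNr.
move=> N [[N1 N2] [/= N1L N2y] N12].
have [xs [U [U0 UN1]]] := nbhs_pointwise N1L.
have V0 : nbhs 0 (U `&` [set v | N2 (y + v)]).
  apply: filterI => //.
  have := nbhsB (- y) N2y; rewrite addNr; apply: filterS => _ [v N2v <-] /=.
  by rewrite addrA subrr add0r.
have [e e0 eV] := nbhs0_scale k0 V0.
have [[xi b] [zeta /= D] [/= be xie]] :=
  dual_set_approx W_closed W_convex W_up W_ge0 W_feas xs e0.
have [P PE] := rank_one xi k0; have [T TE] := rank_one zeta k0.
(* W is stable under adding elements of S to z, so zeta is bounded below along
   the rays of S. *)
have zetaS s : S s -> 0 <= zeta s :> R.
  move=> Ss; have [x1 [m1 /WP[Cx1 [/epiP[g [s1 [/= Gx1 Ss1 gs]]] F1]]]] := W_feas.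
  apply: (@affine_ge0_slope _ (m1 - (xi x1 : R) + b)) => t t0.
  have /D : W (x1, t *: s, m1).
    apply/WP; do 2?split=> //; apply/epiP; exists g, (s1 + t *: s); split=> //=.
      by apply: coneD => //; apply: S_cone => //; exact: ltW.
    by rewrite addrA -gs add0r.
  have -> : zeta (t *: s) = t * (zeta s : R) :> R by rewrite linearZ.
  by congr (_ <= _); ring.
exists (L + P, y + b *: k0); split.
  exists T.
    apply/seteqP; split=> // _ [[s Ss <-] [k Kk kE]].
    have := congr1 (fun v => phi v : R) kE; rewrite TE linearN linearZ/= phik0.
    have := phi_int _ Kk; have := zetaS _ Ss; rewrite -[zeta s *: _]/((zeta s : R) * 1); lra.
  have phiT z : phi (T z) = zeta z :> R by rewrite TE linearZ/= phik0; exact: mulr1.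
  have phiP x : phi (P x) = xi x :> R by rewrite PE linearZ/= phik0; exact: mulr1.
  move=> x f g s Cx Ss Fx Gx /phi_int.
  have -> : phi (T (- s) - (f + T g - (L + P) x + (y + b *: k0))) =
      - (zeta s : R) - ((phi f : R) + (zeta g : R) -
        ((phi (L x) : R) + (xi x : R)) + ((phi y : R) + b)) :> R.
    rewrite linearN -phiT -(phiT g) -phiP -[b in RHS]mulr1 -phik0.
    by rewrite !(linearB, linearD, linearN) linearZ.
  have /D : W (x, g, (phi f : R) - (phi (L x) : R) + (phi y : R)).
    apply/WP; do 2?split=> //; last by exists f => //; lra.
    by apply/epiP; exists g, 0; rewrite addr0.
  have := zetaS _ Ss; lra.
apply: N12; split=> /=; last by have [] := eV _ be.
apply: UN1 => x /xie xx.
have -> : (L + P) x - L x = (xi x : R) *: k0.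
  by rewrite -PE -[(L + P) x]/(L x + P x) addrAC subrr add0r.
by have [] := eV _ xx.
Qed.

End Approximation_of_primal_bounds.

(** * Closedness and the Farkas equivalence *)

Local Open Scope ereal_scope.

Theorem theorem4p5 (R : realType) (X Y Z : tvsType R)
    (hX : hausdorff_space X) (hY : hausdorff_space Y) (hZ : hausdorff_space Z)
    (K : set Y) (K_closed : closed K) (K_pointed : is_pointed K)
    (K_convex : convex_set (K : set (convex_lmodType Y))) (K_cone : is_cone K)
    (K_int : K° !=set0)
    (S : set Z) (S_neq0 : S !=set0) (S_closed : closed S)
    (S_convex : convex_set (S : set (convex_lmodType Z))) (S_cone : is_cone S)
    (C : set X) (C_neq0 : C !=set0) (C_closed : closed C)
    (C_convex : convex_set (C : set (convex_lmodType X)))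
    (F : X -> \bar Y) (F_proper : proper_map F) (F_convex : Kconvex K F)
    (F_lsc : forall ystar : 'L(Y, R^o),
      lower_semicontinuous (er_map ystar \o F : X -> \bar R))
    (G : X -> \bar Z) (G_proper : proper_map G) (G_convex : Kconvex S G)
    (G_closed : epi_closed S G)
    (A_domF : (C `&` G @^-1` (EFin @` (-%R @` S))) `&` effdom F !=set0) :
  closed (\bigcup_(T in Lplus_w S K)
      \bigcap_(v in [set v : Y | conjugate K (indicator (-%R @` S)) T v%:E])
        [set (p + ((0 : 'L(X, Y)), v))%R |
          p in sepi K (conjugate K (fun x => F x + indicator C x + er_map T (G x)))])
  <->
  (forall (L : 'L(X, Y)) (y : Y),
    (forall x, C x -> (EFin @` (-%R @` S)) (G x) ->
       ~ (EFin @` (-%R @` K°)) (F x - (L x)%:E + y%:E))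
    <->
    (exists2 T : 'L(Z, Y), Lplus_w S K T & forall x, C x ->
       ~ (EFin @` [set (u - k)%R | u in T @` (-%R @` S) & k in K°])
           (F x + er_map T (G x) - (L x)%:E + y%:E))).
Proof.
have FNoo : forall x, F x <> -oo := F_proper.2.
have GNoo : forall x, G x <> -oo := G_proper.2.
have feasible : exists x f s, [/\ C x, S s, F x = f%:E & G x = (- s)%:E].
  have [x [[Cx [_ [s Ss <-] Gx]] domx]] := A_domF.
  have := FNoo x; case Fx : (F x) => [f| |] // _.
  by exists x, f, s.
have feasible' : exists x f g, [/\ C x, F x = f%:E & G x = g%:E].
  by have [x [f [s [Cx _ Fx Gx]]]] := feasible; exists x, f, (- s)%R.
pose B := [set p : 'L(X, Y) * Y | exists2 T, Lplus_w S K T &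
  dual_bound_by K S C F G T p.1 p.2].
pose E := [set p : 'L(X, Y) * Y | primal_bound K S C F G p.1 p.2].
have BE : B `<=` E.
  by move=> p [T _]; exact: dual_bound_by_primal.
set M := \bigcup_(T in _) _; have -> : M = B.
  apply/seteqP; split=> -[L y] [T TS].
    move=> /(bigcap_epi_conjugateP K_convex K_cone K_int FNoo GNoo feasible' _ _ TS).
    by exists T.
  move=> h; exists T => //.
  exact/(bigcap_epi_conjugateP K_convex K_cone K_int FNoo GNoo feasible' _ _ TS).
have -> : (forall (L : 'L(X, Y)) (y : Y),
    (forall x, C x -> (EFin @` (-%R @` S)) (G x) ->
       ~ (EFin @` (-%R @` K°)) (F x - (L x)%:E + y%:E))
    <->
    (exists2 T : 'L(Z, Y), Lplus_w S K T & forall x, C x ->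
       ~ (EFin @` [set (u - k)%R | u in T @` (-%R @` S) & k in K°])
           (F x + er_map T (G x) - (L x)%:E + y%:E))) <-> E `<=` B.
  split=> [h [L y] /primal_boundP/h[T TS /dual_bound_byP]|h L y]; first by exists T.
  split=> [/primal_boundP/(h (L, y))[T TS hT]|[T TS /dual_bound_byP hT]].
    by exists T => //; exact/dual_bound_byP.
  by apply/primal_boundP/(BE (L, y)); exists T.
split=> [/closure_id -> [L y] Lyp|EB].
  exact: primal_bound_approx.
have -> : B = E by apply/seteqP.
exact: primal_bound_closed.
Qed.
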